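(* Let $G$ be any finite simple graph. Then \[ \left|I(G;-1)\right| \le 2^{\phi_3(G)}. \]
   Context: For a finite simple graph $G$, the independence polynomial is $I(G;x)=\sum_{k\ge 0} i_k(G)x^k$, where $i_k(G)$ is the number of independent sets of $G$ of size $k$ (with $i_0(G)=1$, counting the empty set). A $\tilde{3}$-cycle is a cycle whose length is divisible by $3$. A graph is called ternary if it contains no induced $\tilde{3}$-cycle. A set $D\subseteq V(G)$ is a $\tilde{3}$-decycling set of $G$ if $G-D$ is ternary. The ternary decycling number $\phi_3(G)$ is the minimum size of a $\tilde{3}$-decycling set of $G$. *)

(* Defs.v *)
From mathcomp Require Import all_boot all_order all_algebra.
From Stdlib Require Import Classical ClassicalEpsilon.
Set Implicit Arguments. Unset Strict Implicit. Unset Printing Implicit Defensive.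
Import Order.TTheory GRing.Theory Num.Theory.

Definition simple_graph (T : finType) (e : rel T) : Prop :=
  symmetric e /\ irreflexive e.

Definition independent (T : finType) (e : rel T) (S : {set T}) : bool :=
  [forall x in S, forall y in S, ~~ e x y].

Definition indep_poly_at_m1 (T : finType) (e : rel T) : int :=
  (\sum_(S : {set T} | independent e S) (-1) ^+ #|S|)%R.

Definition induced_cycle (T : finType) (e : rel T) (s : seq T) : Prop :=
  [/\ 3 <= size s, uniq s &
   forall (x0 : T) i j, i < size s -> j < size s ->
     e (nth x0 s i) (nth x0 s j)
     = (j == i.+1 %% size s) || (i == j.+1 %% size s)].

Definition ternary_on (T : finType) (e : rel T) (A : {set T}) : Prop :=
  ~ exists s : seq T, [/\ all (fun v => v \in A) s, induced_cycle e s & 3 %| size s].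

Definition decycling3 (T : finType) (e : rel T) (D : {set T}) : Prop :=
  ternary_on e (~: D).

Definition decycling3b (T : finType) (e : rel T) (D : {set T}) : bool :=
  if excluded_middle_informative (decycling3 e D) then true else false.

(* phi_3(G) = minimum size of a 3~-decycling set (the default #|T| is never
   smaller than the minimum, since setT is always decycling) *)
Definition phi3 (T : finType) (e : rel T) : nat :=
  \big[minn/#|T|]_(D : {set T} | decycling3b e D) #|D|.

(* Main.v *)
Require Import Defs.
From HB Require Import structures.
From mathcomp Require Import all_boot all_order all_algebra.
From mathcomp Require Import zify.
From Stdlib Require Import Classical ClassicalEpsilon.
Set Implicit Arguments. Unset Strict Implicit. Unset Printing Implicit Defensive.
Import Order.TTheory GRing.Theory Num.Theory.

(** The recursion I(G) = I(G - x) - I(G - N[x]) at -1, applied to the vertices of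
    a decycling set, reduces everything to |I(G; -1)| <= 1 for ternary G, and this
    follows once the independence complex of a ternary graph has total Betti
    number at most 1 over F_2.  In a minimal counterexample G every proper induced
    subgraph J is acyclic or has a single class, of degree d(J), and the long exact
    sequence of (J, J - x) ties d(J), d(J - x) and d(J - N[x]) together.  It follows
    that d(G - v) is constant, that "G - u - v is not acyclic" is an equivalence
    relation whose classes are stable, that every vertex has two inequivalent
    neighbours, and that on a path x1 x2 x3 x4 with x1, x3 inequivalent and x2, x4
    inequivalent, x1 and x4 are equivalent.  A walk avoiding the class of its
    last-but-one vertex therefore visits three classes periodically; orienting
    edges along this cyclic order, a shortest directed cycle is an induced cycle
    of length divisible by 3. *)

(** * Chains over a field of characteristic two *)

Section Chains.
Local Open Scope ring_scope.
Variables (F : fieldType) (T : finType).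
Hypothesis F2 : 1 + 1 = 0 :> F.

Notation chain := {ffun {set T} -> F^o}.
Implicit Types (c : chain) (S : {set T}) (x y : T) (P : pred {set T}).

Lemma addrr_F2 (a : F^o) : a + a = 0.
Proof. by rewrite -[a in LHS]mulr1 -mulrDr F2 mulr0. Qed.

(** Off the diagonal the terms at (x, y) and (y, x) cancel; [enum_rank] selects one of each pair. *)
Lemma sum_symm_F2 (g : T -> T -> F^o) :
  (forall x y, g x y = g y x) -> (forall x, g x x = 0) ->
  \sum_x \sum_y g x y = 0.
Proof.
move=> gC g0; pose lt x y := (enum_rank x < enum_rank y)%N.
have -> : \sum_x \sum_y g x y
    = \sum_x \sum_(y | lt x y) g x y + \sum_x \sum_(y | lt y x) g x y.
  rewrite -big_split; apply: eq_bigr => x _ /=.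
  rewrite (bigID (lt x)) /=; congr (_ + _).
  rewrite (bigD1 x) /= ?g0 ?add0r /lt ?ltnn //; apply: eq_bigl => y.
  by rewrite -leqNgt [RHS]ltn_neqAle andbC -(inj_eq enum_rank_inj).
rewrite [X in _ + X](_ : _ = \sum_x \sum_(y | lt x y) g x y) ?addrr_F2 //.
by rewrite [LHS](exchange_big_dep predT) //=; do 2!apply: eq_bigr => ? _.
Qed.

Definition restr P c : chain := [ffun S => if P S then c S else 0].

Fact restr_is_linear P : linear (restr P).
Proof.
by move=> a u v; apply/ffunP=> S; rewrite !ffunE; case: ifP; rewrite ?scaler0 ?addr0.
Qed.
HB.instance Definition _ P := GRing.isLinear.Build _ _ _ _ (restr P) (restr_is_linear P).

(* Locked so that [memv_ker] does not fire on memberships in [chains_on P]. *)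
Definition chains_on P : {vspace chain} :=
  locked (lker (linfun (restr (predC P)))).

Lemma chains_onP P c : reflect (forall S, ~~ P S -> c S = 0) (c \in chains_on P).
Proof.
rewrite /chains_on -lock memv_ker lfunE; apply: (iffP eqP) => [/ffunP c0 S PS | c0].
  by have := c0 S; rewrite !ffunE /= PS.
by apply/ffunP=> S; rewrite !ffunE /=; case: ifP => // /c0.
Qed.

(** The simplicial boundary read off by coefficients, without signs. The empty face takes part, so
    the homology is reduced. *)
Definition bdry_fun c : chain := [ffun S : {set T} => \sum_(x | x \notin S) c (x |: S)].

Fact bdry_is_linear : linear bdry_fun.
Proof.
move=> a u v; apply/ffunP=> S; rewrite !ffunE scaler_sumr -big_split.
by apply: eq_bigr => x _; rewrite !ffunE.
Qed.
HB.instance Definition _ := GRing.isLinear.Build _ _ _ _ bdry_fun bdry_is_linear.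
Definition bdry := linfun bdry_fun.

Lemma bdryE c S : bdry c S = \sum_(x | x \notin S) c (x |: S).
Proof. by rewrite lfunE ffunE. Qed.

Lemma bdryK c : bdry (bdry c) = 0.
Proof.
apply/ffunP=> S; rewrite bdryE ffunE.
pose g x y := if [&& x \notin S, y \notin S & x != y] then c (y |: (x |: S)) else 0.
rewrite -[RHS](@sum_symm_F2 g); first 1 last.
- by move=> x y; rewrite /g setUCA andbCA (eq_sym y).
- by move=> x; rewrite /g eqxx !andbF.
rewrite big_mkcond; apply: eq_bigr => x _; rewrite /g.
case: ifP => xS; last by rewrite /= big1.
rewrite bdryE big_mkcond; apply: eq_bigr => y _.
by rewrite !inE negb_or eq_sym andbC.
Qed.

(** Together with [cone], this identifies chains on faces through x with chains on the link of x;
    its kernel consists of the chains avoiding x. *)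
Definition link_fun x c : chain := [ffun S : {set T} => if x \in S then 0 else c (x |: S)].
Fact link_is_linear x : linear (link_fun x).
Proof.
by move=> a u v; apply/ffunP=> S; rewrite !ffunE; case: ifP; rewrite ?scaler0 ?addr0.
Qed.
HB.instance Definition _ x := GRing.isLinear.Build _ _ _ _ (link_fun x) (link_is_linear x).
Definition link x := linfun (link_fun x).

Lemma linkE x c S : link x c S = if x \in S then 0 else c (x |: S).
Proof. by rewrite lfunE ffunE. Qed.

Definition cone x c : chain := [ffun S : {set T} => if x \in S then c (S :\ x) else 0].

Lemma link_bdry x c : link x (bdry c) = bdry (link x c).
Proof.
apply/ffunP=> S; rewrite linkE !bdryE; case: ifPn => xS.
  by rewrite big1 // => y _; rewrite linkE !inE xS orbT.
rewrite [RHS](bigD1 x) //= linkE setU11 add0r.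
apply: eq_big => [y | y]; first by rewrite !inE negb_or andbC.
by rewrite !inE negb_or => /andP[yx yS]; rewrite linkE !inE eq_sym (negPf yx) (negPf xS) setUCA.
Qed.

Lemma link_cone x c : (forall S, x \in S -> c S = 0) -> link x (cone x c) = c.
Proof.
move=> c0; apply/ffunP=> S; rewrite linkE; case: ifPn => [/c0-> // | xS].
by rewrite ffunE setU11 setU1K.
Qed.

Lemma bdry_cone x c : (forall S, x \in S -> c S = 0) ->
  bdry (cone x c) = c + cone x (bdry c).
Proof.
move=> c0; apply/ffunP=> S; rewrite bdryE !ffunE; case: ifPn => xS.
  rewrite c0 // add0r bdryE [RHS](bigD1 x) ?setD11 //= c0 ?setU11 // add0r.
  apply: eq_big => [y | y yS]; first by rewrite !inE; case: eqP => [->|]; rewrite ?xS //= andbT.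
  rewrite ffunE !inE xS orbT; congr (c _); apply/setP=> z; rewrite !inE.
  by case: (z =P x) => // ->; rewrite andFb orbF; case: eqP yS => // <-; rewrite xS.
rewrite addr0 (bigD1 x) //= ffunE setU11 setU1K // big1 ?addr0 // => y /andP[yS yx].
by rewrite ffunE !inE eq_sym (negPf yx) (negPf xS).
Qed.

End Chains.

(** * Betti numbers of independence complexes *)

Section Homology.
Local Open Scope ring_scope.
Variables (F : fieldType) (T : finType) (e : rel T).
Hypothesis F2 : 1 + 1 = 0 :> F.
Hypotheses (e_sym : symmetric e) (e_irr : irreflexive e).

Notation chain := {ffun {set T} -> F^o}.
Implicit Types (c : chain) (A S : {set T}) (x y : T) (k : nat).

Definition nbh x : {set T} := x |: [set y | e x y].

Definition face k A : pred {set T} :=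
  fun S => [&& independent e S, S \subset A & #|S| == k].

Lemma independentP S :
  reflect {in S &, forall x y, ~~ e x y} (independent e S).
Proof.
apply: (iffP forall_inP) => [H x y xS yS | H x xS].
  by have /forall_inP := H x xS; apply.
by apply/forall_inP => y; apply: H.
Qed.

Lemma independent_setU1 x S :
  independent e (x |: S) = independent e S && [disjoint S & [set y | e x y]].
Proof.
apply/independentP/andP => [H | [/independentP H dS] y z].
  split; first by apply/independentP=> y z yS zS; apply: H; rewrite !inE ?yS ?zS orbT.
  apply/pred0P=> y /=; apply/andP=> -[yS]; rewrite inE.
  by apply/negP/H; rewrite !inE ?yS ?eqxx ?orbT.
have N u : u \in S -> ~~ e x u by move=> uS; have := disjointFr dS uS; rewrite inE => ->.
rewrite !inE => /orP[/eqP-> | yS] /orP[/eqP-> | zS]; rewrite ?e_irr ?N //; last exact: H.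
by rewrite e_sym N.
Qed.

Lemma face_setU1 k A x S : x \in A -> x \notin S ->
  face k.+1 A (x |: S) = face k (A :\: nbh x) S.
Proof.
move=> xA xS; rewrite /face independent_setU1 cardsU1 xS add1n eqSS subUset sub1set xA /=.
have -> : (S \subset A :\: nbh x) = (S \subset A) && [disjoint S & [set y | e x y]].
  by rewrite subsetD !disjoints_subset setCU subsetI subsetC sub1set inE xS.
by rewrite -!andbA; congr (_ && _); rewrite andbCA.
Qed.

Lemma face_setD1 k A x S : face k (A :\ x) S = face k A S && (x \notin S).
Proof. by rewrite /face subsetD1 -!andbA; do 2!congr (_ && _); rewrite andbC. Qed.

Definition chains k A : {vspace chain} := chains_on F (face k A).
Definition cycles k A : {vspace chain} := (chains k A :&: lker (bdry F T))%VS.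
Definition bounds k A : {vspace chain} := (bdry F T @: chains k.+1 A)%VS.
(* Degrees count vertices: [betti k A] is the reduced Betti number of the
   independence complex of G[A] in dimension k - 1. *)
Definition betti k A := (\dim (cycles k A) - \dim (bounds k A))%N.

Lemma face_del k A x S : x \notin S -> face k.+1 A (x |: S) -> face k A S.
Proof.
move=> xS; rewrite /face independent_setU1 cardsU1 xS eqSS subUset.
by case/and3P=> /andP[-> _] /andP[_ ->] ->.
Qed.

Lemma bounds_sub k A : (bounds k A <= cycles k A)%VS.
Proof.
apply/subvP=> _ /memv_imgP[c /chains_onP c0 ->].
rewrite memv_cap memv_ker (bdryK F2) eqxx andbT; apply/chains_onP => S FS.
by rewrite bdryE big1 // => x xS; apply/c0; apply: contra FS; apply: face_del.
Qed.

Lemma dim_chains k A : \dim (chains k.+1 A) = (\dim (cycles k.+1 A) + \dim (bounds k A))%N.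
Proof. by rewrite -(limg_ker_dim (bdry F T)). Qed.

Section Delete.
Variables (A : {set T}) (x : T).
Hypothesis xA : x \in A.
Let B := A :\ x.
Let C := A :\: nbh x.

Lemma chainsD1 k : (chains k A :&: lker (link F x))%VS = chains k B.
Proof.
apply/vspaceP=> c; rewrite memv_cap memv_ker; apply/andP/chains_onP.
  case=> /chains_onP c0 /eqP/ffunP lc S; rewrite face_setD1 negb_and negbK.
  case/orP=> [/c0 // | xS]; have := lc (S :\ x).
  by rewrite linkE setD11 setD1K // ffunE.
move=> c0; split.
  by apply/chains_onP=> S nF; apply: c0; rewrite face_setD1 (negPf nF).
apply/eqP/ffunP=> S; rewrite linkE ffunE; case: ifP => // _.
by apply: c0; rewrite face_setD1 setU11 andbF.
Qed.

Lemma chains_avoid k c S : c \in chains k C -> x \in S -> c S = 0.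
Proof.
move=> /chains_onP c0 xS; apply: c0; apply/and3P=> -[_ /subsetP /(_ x xS)].
by rewrite !inE eqxx.
Qed.

Lemma link_chains k c : c \in chains k.+1 A -> link F x c \in chains k C.
Proof.
move=> /chains_onP c0; apply/chains_onP=> S nF; rewrite linkE.
by case: ifPn => // xS; apply: c0; rewrite face_setU1.
Qed.

Lemma cone_chains k c : c \in chains k C -> cone x c \in chains k.+1 A.
Proof.
move=> /chains_onP c0; apply/chains_onP=> S nF; rewrite ffunE.
case: ifP => // xS; apply: c0; rewrite -face_setU1 ?setD11 //.
by rewrite setD1K.
Qed.

Lemma link_coneK k c : c \in chains k C -> link F x (cone x c) = c.
Proof. by move=> cC; apply: link_cone => S; apply: chains_avoid cC. Qed.

Lemma chains0D1 : chains 0 A = chains 0 B.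
Proof.
apply/vspaceP=> c; suff fE S : face 0 A S = face 0 B S.
  by apply/chains_onP/chains_onP=> H S; move: (H S); rewrite fE.
rewrite face_setD1 /face cards_eq0.
by case: eqP => [->|]; rewrite ?andbF ?inE ?andbT.
Qed.

(** Modulo [bounds k B], this is the kernel of the map from the homology of B to that of A, or
    equally the image of the homology of C in that of B. *)
Let X k := (bounds k A :&: lker (link F x))%VS.

Lemma dim_boundsS k : \dim (bounds k.+1 A) = (\dim (X k.+1) + \dim (bounds k C))%N.
Proof.
rewrite -(limg_ker_dim (link F x)); congr (_ + \dim _)%N; apply/vspaceP=> c.
apply/memv_imgP/memv_imgP=> -[u].
  by case/memv_imgP=> w wA -> ->; exists (link F x w); rewrite ?link_chains ?link_bdry.
move=> uC ->; exists (bdry F T (cone x u)); first by rewrite memv_img ?cone_chains.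
by rewrite link_bdry (link_coneK uC).
Qed.

Lemma link_bdry0 u : u \in chains 1 A -> bdry F T (link F x u) = 0.
Proof.
move/link_chains/chains_onP=> c0; apply/ffunP=> S; rewrite bdryE ffunE big1 // => y yS.
apply: c0; apply/and3P=> -[_ _]; rewrite cards_eq0 => /eqP/setP/(_ y).
by rewrite !inE eqxx.
Qed.

Lemma dim_bounds0 : \dim (bounds 0 A) = \dim (X 0).
Proof.
congr (\dim _); apply/esym/capv_idPl/subvP=> _ /memv_imgP[u uA ->].
by rewrite memv_ker link_bdry link_bdry0.
Qed.

Lemma bounds_subX k : (bounds k B <= X k)%VS.
Proof.
apply/subvP=> c /memv_imgP[u]; rewrite -chainsD1 memv_cap => /andP[uA].
by rewrite !memv_ker => /eqP lu ->; rewrite memv_cap memv_img // memv_ker link_bdry lu linear0 eqxx.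
Qed.

Lemma X_sub k : (X k <= cycles k B)%VS.
Proof.
apply/subvP=> c; rewrite !memv_cap => /andP[/(subvP (bounds_sub k A))].
by rewrite memv_cap -chainsD1 memv_cap => /andP[-> ->] ->.
Qed.

(** Counting this space once through [bdry] and once through [link] replaces the construction of a
    connecting map. *)
Let V k := (chains k.+1 A :&: lker (bdry F T \o link F x)%VF)%VS.

Lemma dimV_bdry k : \dim (V k) = (\dim (cycles k.+1 A) + \dim (X k))%N.
Proof.
rewrite -(limg_ker_dim (bdry F T)); congr (_ + _)%N; congr (\dim _); apply/vspaceP=> c.
  rewrite !memv_cap !memv_ker; case: (c \in chains _ _) => //=.
  rewrite comp_lfunE -link_bdry; case: (bdry F T c =P 0) => [->|]; rewrite ?andbF //.
  by rewrite linear0 eqxx.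
apply/memv_imgP/idP => [[u] | ].
  rewrite memv_cap memv_ker comp_lfunE -link_bdry => /andP[uA lu ->].
  by rewrite memv_cap memv_ker lu memv_img.
rewrite memv_cap memv_ker => /andP[/memv_imgP[u uA ->] lu]; exists u => //.
by rewrite memv_cap memv_ker uA comp_lfunE -link_bdry.
Qed.

Lemma dimV_link k : \dim (V k) = (\dim (chains k.+1 B) + \dim (cycles k C))%N.
Proof.
rewrite -(limg_ker_dim (link F x)); congr (_ + _)%N; congr (\dim _); apply/vspaceP=> c.
  rewrite -chainsD1 !memv_cap !memv_ker comp_lfunE; case: (c \in _) => //=.
  by case: (link F x c =P 0) => [->|]; rewrite ?andbF // linear0 eqxx.
apply/memv_imgP/idP => [[u] | ].
  rewrite memv_cap memv_ker comp_lfunE => /andP[uA lu ->].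
  by rewrite memv_cap memv_ker lu link_chains.
rewrite memv_cap memv_ker => /andP[cC bc]; exists (cone x c).
  by rewrite memv_cap cone_chains // memv_ker comp_lfunE (link_coneK cC).
by rewrite (link_coneK cC).
Qed.

(** Boundaries of cones over chains of C are cycles of A, and their links exhaust the boundaries of
    C. *)
Lemma dim_cycles_ge k : (\dim (cycles k.+1 B) + \dim (bounds k C) <= \dim (cycles k.+1 A))%N.
Proof.
rewrite -(limg_ker_dim (link F x) (cycles k.+1 A)) leq_add ?dimvS //.
  by apply/subvP=> c; rewrite !memv_cap -chainsD1 memv_cap -!andbA; case/and3P=> -> -> ->.
apply/subvP=> _ /memv_imgP[u uC ->]; apply/memv_imgP; exists (bdry F T (cone x u)).
  by apply: (subvP (bounds_sub _ _)); rewrite memv_img ?cone_chains.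
by rewrite link_bdry (link_coneK uC).
Qed.

(* Numerical trace of the long exact sequence of the pair (A, A - x): [delta k]
   is the rank of the map in degree k induced by the inclusion of C in B. *)
Lemma betti_les : exists delta : nat -> nat,
  [/\ forall k, (delta k <= betti k B)%N, forall k, (delta k <= betti k C)%N,
      (betti 0 A + delta 0 = betti 0 B)%N &
      forall k, (betti k.+1 A + delta k + delta k.+1 = betti k.+1 B + betti k C)%N].
Proof.
exists (fun k => \dim (X k) - \dim (bounds k B))%N; rewrite /betti; split.
- by move=> k; rewrite leq_sub2r // dimvS ?X_sub.
(* The two counts of [V k] turn this difference into dim cycles k+1 B + dim cycles k C - dim cycles
   k+1 A, which [dim_cycles_ge] bounds. *)
- move=> k; have := dimV_bdry k; have := dimV_link k; have := dim_chains k B.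
  by have := dim_cycles_ge k; lia.
- have := dimvS (bounds_subX 0); have := dimvS (X_sub 0).
  rewrite dim_bounds0 /cycles chains0D1; lia.
move=> k; have := dimV_bdry k; have := dimV_link k; have := dim_chains k B.
have := dim_cycles_ge k; have := dim_boundsS k.
have := dimvS (bounds_sub k.+1 A).
have := dimvS (bounds_subX k.+1); have := dimvS (X_sub k.+1).
have := dimvS (bounds_subX k); have := dimvS (X_sub k).
have := dimvS (bounds_sub k C); lia.
Qed.

(** An isolated x makes the complex a cone with apex x: every cycle bounds the cone over its part
    [b] off x. *)
Lemma betti_isolated k : {in A, forall y, ~~ e x y} -> betti k A = 0%N.
Proof.
move=> iso; apply/eqP; rewrite subn_eq0 dimvS //.
have AB S : face k A S -> x \notin S -> face k C S.
  case/and3P=> indS /subsetP SA cS xS; rewrite /face indS cS andbT; apply/subsetP=> y yS.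
  rewrite !inE SA // andbT negb_or iso ?SA // andbT.
  by apply: contraNneq xS => <-.
apply/subvP=> c; rewrite memv_cap memv_ker => /andP[/chains_onP c0 /eqP bc].
pose b : chain := [ffun S : {set T} => if x \in S then 0 else c S].
have b0 S : x \in S -> b S = 0 by rewrite ffunE => ->.
have bC : b \in chains k C.
  apply/chains_onP=> S nF; rewrite ffunE; case: ifPn => // xS; apply: c0.
  by apply: contra nF => fS; apply: AB.
apply/memv_imgP; exists (cone x b); first exact: cone_chains.
rewrite (bdry_cone b0); apply/ffunP=> S; rewrite !ffunE; case: ifP => xS; last by rewrite addr0.
have := congr1 (fun f : chain => f (S :\ x)) bc; rewrite /= bdryE ffunE.
rewrite (bigD1 x) ?setD11 //= setD1K // add0r bdryE => bc0.
rewrite (bigD1 x) ?setD11 //= [b _]ffunE setU11 add0r.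
rewrite (eq_bigr (fun y => c (y |: (S :\ x)))).
  move/eqP: bc0; set s := \sum_(_ | _) _; rewrite addr_eq0 => /eqP->.
  by rewrite ?add0r; apply/eqP; rewrite eq_sym -subr_eq0 opprK (addrr_F2 F2).
by move=> y /andP[_ yx]; rewrite ffunE !inE eqxx eq_sym (negPf yx).
Qed.

End Delete.

Lemma betti_set0 k : betti k set0 = (k == 0)%N.
Proof.
have ch0 j : chains j.+1 set0 = 0%VS.
  apply/vspaceP=> c; rewrite memv0; apply/chains_onP/eqP=> [c0 | -> S _]; last by rewrite ffunE.
  apply/ffunP=> S; rewrite ffunE; apply: c0; apply/and3P=> -[_].
  by rewrite subset0 => /eqP->; rewrite cards0.
rewrite /betti /bounds ch0 limg0 dimv0 subn0 /cycles.
case: k => [|k]; last by rewrite ch0 cap0v dimv0.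
pose u : chain := [ffun S => if S == set0 then 1 else 0].
suff -> : (chains 0 set0 :&: lker (bdry F T))%VS = <[u]>%VS.
  rewrite dim_vline; case: (u =P 0) => // /ffunP/(_ set0); rewrite !ffunE eqxx.
  by move/eqP; rewrite oner_eq0.
apply/vspaceP=> c; rewrite memv_cap; apply/andP/vlineP => [[/chains_onP c0 _] | [a ->]].
  exists (c set0); apply/ffunP=> S; rewrite !ffunE; case: eqP => [->|S0].
    by rewrite /GRing.scale /= mulr1.
  rewrite scaler0; apply: c0; rewrite /face cards_eq0; apply/and3P=> -[_ _ /eqP] //.
split; first apply/chains_onP=> S nF.
  rewrite !ffunE; case: eqP nF => [->|_ _]; rewrite ?scaler0 //.
  rewrite /face sub0set cards0 andbT => /negP[].
  by apply/independentP=> ? ?; rewrite inE.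
rewrite memv_ker; apply/eqP/ffunP=> S; rewrite bdryE ffunE big1 // => y yS.
by rewrite !ffunE -cards_eq0 cardsU1 yS scaler0.
Qed.

End Homology.

(* A Betti sequence of total at most 1: [None] for an acyclic complex, [Some k]
   for a single class, in degree k. *)
Definition single (b : nat -> nat) (o : option nat) := forall k, b k = (o == Some k).

(* The degrees of G[J], G[J - x] and G[J - N[x]], in this order, that the long
   exact sequence allows when all three have total Betti number at most 1. *)
Definition delete_link (a b c : option nat) : bool :=
  match a, b, c with
  | Some i, Some j, None => i == j
  | Some i, None, Some k => i == k.+1
  | None, Some j, Some k => j == k
  | None, None, None => true
  | _, _, _ => false
  end.

Lemma single_uniq b o1 o2 : single b o1 -> single b o2 -> o1 = o2.
Proof.
move=> h1 h2; case: o1 h1 => [i|] h1.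
  by have := h1 i; rewrite h2 eqxx; case: eqP.
case: o2 h2 => [j|] // h2.
by have := h2 j; rewrite h1 eqxx.
Qed.

(** [dl] is at most one, and nonzero only where B and C both have their class. Two such classes
    either cancel, in a common degree, or both survive, the one from C a degree higher. *)
Lemma single_les (bA bB bC dl : nat -> nat) oB oC :
  (forall k, dl k <= bB k)%N -> (forall k, dl k <= bC k)%N ->
  (bA 0 + dl 0 = bB 0)%N ->
  (forall k, bA k.+1 + dl k + dl k.+1 = bB k.+1 + bC k)%N ->
  single bB oB -> single bC oC ->
  (exists2 oA, single bA oA & delete_link oA oB oC) \/
  (exists a c, [/\ oB = Some a, oC = Some c & forall k, bA k = ((k == a) + (k == c.+1))%N]).
Proof.
move=> dB dC d0 dS hB hC.
have SomeE j k : (Some j == Some k :> option nat) = (j == k) by [].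
case: oB hB => [j|] hB; case: oC hC => [i|] hC.
- have dl0 k : k != j -> dl k = 0%N.
    by move=> kj; have := dB k; rewrite hB SomeE eq_sym (negPf kj); lia.
  have dl0' k : k != i -> dl k = 0%N.
    by move=> kj; have := dC k; rewrite hC SomeE eq_sym (negPf kj); lia.
  have dlj : (dl j <= 1)%N by have := dB j; rewrite hB eqxx.
  case: (posnP (dl j)) => [dlj0 | dlj1].
    have dl00 k : dl k = 0%N by have [->|/dl0] := eqVneq k j.
    right; exists j, i; split=> // -[|k].
      by have := d0; rewrite hB SomeE dl00; lia.
    by have := dS k; rewrite hB hC !SomeE !dl00; lia.
  have ij : j = i by apply/eqP; apply: contraLR dlj1 => /dl0' ->.
  left; exists None; last by rewrite ij /= eqxx.
  have dlE k : dl k = (k == j) by have [->|/dl0->] := eqVneq k j; lia.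
  move=> [|k]; first by have := d0; rewrite hB SomeE dlE /=; lia.
  by have := dS k; rewrite hB hC !SomeE !dlE -ij /=; lia.
- have dl0 k : dl k = 0%N by have := dC k; rewrite hC /=; lia.
  left; exists (Some j); last exact: eqxx.
  move=> [|k]; first by have := d0; rewrite dl0 addn0 hB.
  by have := dS k; rewrite !dl0 hB hC /= !addn0.
- have dl0 k : dl k = 0%N by have := dB k; rewrite hB /=; lia.
  left; exists (Some i.+1); last exact: eqxx.
  move=> [|k]; first by have := d0; rewrite dl0 addn0 hB.
  by have := dS k; rewrite !dl0 hB hC /= !addn0 !SomeE eqSS.
have dl0 k : dl k = 0%N by have := dB k; rewrite hB /=; lia.
left; exists None => //.
move=> [|k]; first by have := d0; rewrite dl0 addn0 hB.
by have := dS k; rewrite !dl0 hB hC /= !addn0.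
Qed.

Lemma single_two b o a c :
  single b o -> (forall k, b k = ((k == a) + (k == c))%N) -> False.
Proof.
move=> ho h; have := h a; have := h c; rewrite !ho; case: o {ho} => [i|] /=; last by lia.
by rewrite ![Some _ == Some _](inj_eq (@Some_inj _)); lia.
Qed.

(** * Minimal graphs with total Betti number at least two *)

Section Critical.
Variables (T : finType) (e : rel T) (A : {set T}) (d : {set T} -> option nat).
Hypotheses (e_sym : symmetric e) (e_irr : irreflexive e).
Implicit Types (X Y Z W : {set T}) (u v w x y : T).

Notation N x := (nbh e x).
(** [d J] is the degree of the class of G[J], so [D X] is the degree left once X is deleted. *)
Notation D X := (d (A :\: X)).

Hypothesis d_rule : forall (J : {set T}) x, J \proper A -> x \in J ->
  delete_link (d J) (d (J :\ x)) (d (J :\: N x)).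

Lemma nbh_id x : x \in N x. Proof. by rewrite !inE eqxx. Qed.

(** The vertex u certifies that A minus X is proper; Y and Z are free so that the deleted sets can
    be given in a convenient shape. *)
Lemma del_rule u x X Y Z : u \in A -> u \in X -> x \in A -> x \notin X ->
  x |: X = Y -> N x :|: X = Z -> delete_link (D X) (D Y) (D Z).
Proof.
move=> uA uX xA xX <- <-; have := @d_rule (A :\: X) x.
rewrite !setDDl (setUC X) (setUC X); apply; last by rewrite inE xX.
by rewrite properE subsetDl; apply/subsetPn; exists u; rewrite ?inE ?uX.
Qed.

(* Induction on #|W|: passing from J to J - N[w] with w in W removes w from the
   problem and lowers the degree by one. *)
Lemma delete_down W X k u : u \in A -> u \in X -> W \subset A -> W != set0 ->
  D X = Some k ->
  (forall W', W' != set0 -> W' \proper W -> D (W' :|: X) = None) ->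
  D (W :|: X) = None \/ exists2 j, D (W :|: X) = Some j & (j + #|W| = k.+1)%N.
Proof.
move En: #|W| => n; elim: n => [|n IHn] in W X k En *.
  by move/eqP: En; rewrite cards_eq0 => ->.
move=> uA uX WA W0 DX Dnone.
have /card_gt0P[w wW] : (0 < #|W|)%N by rewrite En.
have wA := subsetP WA w wW.
case: n => [|n] in En IHn *.
  have /eqP/cards1P[w' EW] := En; move: wW; rewrite {}EW inE => /eqP<-.
  have [wX | wX] := boolP (w \in X).
    right; exists k; last by rewrite addn1.
    by rewrite setUC (setUidPl _) ?sub1set.
  have := del_rule uA uX wA wX erefl erefl; rewrite DX.
  case: (D (w |: X)) => [j|]; last by left.
  by case: (D _) => //= /eqP->; right; exists j; rewrite ?addn1.
pose W1 := W :\ w.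
have W1c : #|W1| = n.+1 by have := cardsD1 w W; rewrite wW En => -[].
have W1W : W1 \proper W by rewrite properD1.
have W10 : W1 != set0 by rewrite -card_gt0 W1c.
have w1 : D (w |: X) = None.
  apply: Dnone; first by apply/set0Pn; exists w; rewrite inE.
  by rewrite properEcard sub1set wW cards1 En.
have wX : w \notin X.
  by apply/negP=> wX; move: w1; rewrite setUC (setUidPl _) ?sub1set // DX.
(* Deleting w alone kills the class, so the rule places it in the link of w, one degree lower. *)
have [k' Dk' kE] : exists2 k', D (N w :|: X) = Some k' & k = k'.+1.
  have := del_rule uA uX wA wX erefl erefl; rewrite DX w1.
  by case: (D _) => //= k' /eqP; exists k'.
(* The graph left by deleting [W1 :|: X] is acyclic, so the rule at w makes the two other terms
   agree. *)
have EQ : D (W :|: X) = D (W1 :|: (N w :|: X)).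
  have uY : u \in W1 :|: X by rewrite inE uX orbT.
  have wY : w \notin W1 :|: X by rewrite !inE eqxx (negPf wX).
  have := del_rule uA uY wA wY erefl erefl.
  rewrite setUA setD1K // setUCA Dnone //.
  by case: (D _) (D _) => [?|] [?|] //= /eqP->.
rewrite EQ; case: (IHn W1 (N w :|: X) k') => //; first by rewrite inE uX orbT.
- exact: subset_trans (proper_sub W1W) WA.
- move=> W' W'0 W'W1.
  have wW' : w \notin W' by apply/negP=> /(subsetP (proper_sub W'W1)); rewrite !inE eqxx.
  have uY : u \in W' :|: X by rewrite inE uX orbT.
  have wY : w \notin W' :|: X by rewrite inE (negPf wX) (negPf wW').
  have := del_rule uA uY wA wY erefl erefl.
  rewrite setUA setUCA Dnone ?(proper_trans W'W1 W1W) // Dnone.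
  + by case: (D _).
  + by apply/set0Pn; exists w; rewrite !inE eqxx.
  by rewrite properEcard subUset sub1set wW (proper_sub (proper_trans W'W1 W1W)) cardsU1 wW' En
    ltnS -W1c proper_card.
- by left.
by case=> j Dj jE; right; exists j; rewrite // kE -jE addnS.
Qed.

(* [f] stands for the Betti sequence of G[A], a minimal graph with total Betti
   number at least 2: there the connecting maps vanish. *)
Variable f : nat -> nat.
Hypothesis d_crit : forall v, v \in A -> exists a c, [/\ D [set v] = Some a,
  D (N v) = Some c & forall k, f k = ((k == a) + (k == c.+1))%N].
Hypothesis no_isolated : forall v, v \in A -> exists2 u, u \in A & e v u.

Lemma nbhU_adj u v : e v u -> N v :|: [set u] = N v.
Proof. by move=> uv; apply/setUidPl; rewrite sub1set !inE uv orbT. Qed.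

(** As u lies in N[v], the link of v in G - u is all of G - N[v]; it has a class, which must account
    for that of G - u. *)
Lemma adj_crit u v a c : u \in A -> v \in A -> e u v ->
  D [set u] = Some a -> D (N v) = Some c -> D [set u; v] = None /\ a = c.+1.
Proof.
move=> uA vA uv Da Dc; have vu : v != u by apply: contraTneq uv => ->; rewrite e_irr.
have := @del_rule u v [set u] [set u; v] (N v) uA; rewrite !inE eqxx vu vA => /(_ isT isT isT).
rewrite Da Dc setUC nbhU_adj 1?e_sym // => /(_ erefl erefl).
by case: (D _) => //= /eqP.
Qed.

(** Take a smallest nonempty set W of neighbours of v for which G - v - W has a class; the whole
    neighbourhood qualifies. [delete_down] puts this class in degree a + 1 - |W|, the rule at v
    identifies that degree with c, and [adj_crit] excludes |W| = 1. *)
Lemma nbh_pair v a c : v \in A -> D [set v] = Some a -> D (N v) = Some c ->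
  (c.+1 <= a)%N /\ (a = c.+1 -> exists y y', [/\ y \in A, y' \in A, e v y, e v y' &
     D [set y; y'] = None]).
Proof.
move=> vA Da Dc; pose Y := A :&: [set u | e v u].
pose P W := [&& W != set0, W \subset Y & D (W :|: [set v]) != None].
have PY : P Y.
  apply/and3P; split=> //.
    by have [u uA vu] := no_isolated vA; apply/set0Pn; exists u; rewrite !inE uA.
  suff -> : A :\: (Y :|: [set v]) = A :\: N v by rewrite Dc.
  by apply/setP=> z; rewrite !inE; case: (z \in A); rewrite ?andbF // orbC.
pose W := [arg min_(W < Y | P W) #|W|].
have [PW Wmin] : P W /\ forall W', P W' -> (#|W| <= #|W'|)%N by rewrite /W; case: arg_minnP.
have{PW} /and3P[W0 WY DW] := PW.
have WA : W \subset A by apply: subset_trans WY (subsetIl _ _).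
have adj y : y \in W -> e v y by move/(subsetP WY); rewrite !inE => /andP[].
have vW : v \notin W by apply/negP=> /adj; rewrite e_irr.
have none W' : W' != set0 -> W' \proper W -> D (W' :|: [set v]) = None.
  move=> W'0 W'W; apply/eqP; apply: contraLR (proper_card W'W) => DW'.
  rewrite -leqNgt Wmin // /P W'0 DW' andbT.
  exact: subset_trans (proper_sub W'W) WY.
have /card_gt0P[y yW] : (0 < #|W|)%N by rewrite card_gt0.
have yA := subsetP WA y yW.
have W_gt1 : (1 < #|W|)%N.
  rewrite ltn_neqAle card_gt0 W0 andbT eq_sym; apply: contra DW => /cards1P[y' EW].
  have yy' : y = y' by apply/eqP; move: yW; rewrite EW inE.
  have [a' [c' [Da' _ _]]] := d_crit yA.
  by rewrite EW -yy' (adj_crit yA vA _ Da' Dc).1 // e_sym adj.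
case: (delete_down vA _ WA W0 Da none) => [|/eqP | [j Dj jE]]; first by rewrite inE.
  by rewrite (negPf DW).
have [jc DW0] : j = c /\ D W = None.
  have := @del_rule y v W (W :|: [set v]) (N v) yA yW vA vW.
  rewrite Dj Dc setUC => /(_ erefl).
  have -> : N v :|: W = N v by apply/setUidPl/subsetP=> z /adj; rewrite !inE orbC => ->.
  by case: (D _) => [i|] //= /(_ erefl) => [|/eqP].
split; first by lia.
move=> ac; have /eqP/cards2P[y1 [y2 [_ EW]]] : #|W| = 2 by lia.
by exists y1, y2; rewrite -EW !adj ?(subsetP WA) // EW !inE eqxx ?orbT.
Qed.

(** With primes for a neighbour, [adj_crit] gives a = c' + 1 and a' = c + 1, while [nbh_pair] gives
    c + 1 <= a and c' + 1 <= a'; all are equal. *)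
Lemma crit_adj v a c : v \in A -> D [set v] = Some a -> D (N v) = Some c -> a = c.+1.
Proof.
move=> vA Da Dc; have [u uA vu] := no_isolated vA.
have [a' [c' [Da' Dc' _]]] := d_crit uA.
have [_ h1] := adj_crit vA uA vu Da Dc'; rewrite e_sym in vu.
have [_ h2] := adj_crit uA vA vu Da' Dc.
have [h3 _] := nbh_pair vA Da Dc; have [h4 _] := nbh_pair uA Da' Dc'; lia.
Qed.

(** By [crit_adj], f is twice the indicator of degree c + 1, so it determines c. *)
Lemma crit_const : (exists v, v \in A) -> exists p, forall v, v \in A ->
  D [set v] = Some p.+1 /\ D (N v) = Some p.
Proof.
case=> v0 v0A; have [a [c [Da Dc fE]]] := d_crit v0A; exists c => v vA.
have [a' [c' [Da' Dc' fE']]] := d_crit vA.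
have h1 := crit_adj v0A Da Dc; have h2 := crit_adj vA Da' Dc'.
have cc' : c = c' by have := fE c.+1; rewrite fE'; lia.
by rewrite Da' Dc' h2 cc'.
Qed.

End Critical.

(** * Equivalence of vertices in a minimal graph *)

Section Classes.
Variables (T : finType) (e : rel T) (A : {set T}) (d : {set T} -> option nat) (p : nat).
Hypotheses (e_sym : symmetric e) (e_irr : irreflexive e).
Implicit Types (X Y Z W : {set T}) (u v w x y : T).

Notation N x := (nbh e x).
Notation D X := (d (A :\: X)).

Hypothesis d_rule : forall (J : {set T}) x, J \proper A -> x \in J ->
  delete_link (d J) (d (J :\ x)) (d (J :\: N x)).
Hypothesis D1 : forall v, v \in A -> D [set v] = Some p.+1.
Hypothesis DN : forall v, v \in A -> D (N v) = Some p.

Ltac solve_mem := let z := fresh "z" in move=> z; rewrite !inE;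
  repeat match goal with
  | |- context [z == ?a] => case: (z == a)
  | |- context [e ?a z] => case: (e a z)
  end.

Let del_rule := @del_rule T e A d d_rule.

(* In an induced cycle of length 3k, two vertices are similar exactly when their
   distance is divisible by 3. *)
Definition sim u v := D [set u; v] != None.

Lemma sim_sym u v : sim u v = sim v u.
Proof. by rewrite /sim setUC. Qed.

Lemma sim_refl u : u \in A -> sim u u.
Proof. by move=> uA; rewrite /sim setUid D1. Qed.

(** Since G - u carries a class, exactly one of G - u - v and G - u - N[v] does: the former in
    degree p + 1, the latter in degree p. *)
Lemma sim_rule u v : u \in A -> v \in A -> v != u ->
  delete_link (Some p.+1) (D [set u; v]) (D (N v :|: [set u])).
Proof.
move=> uA vA vu; rewrite -(D1 uA) setUC.
by apply: (@del_rule u v) => //; rewrite inE ?eqxx.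
Qed.

Lemma adj_nsim u v : u \in A -> v \in A -> e u v -> ~~ sim u v.
Proof.
move=> uA vA uv; have vu : v != u by apply: contraTneq uv => ->; rewrite e_irr.
have := sim_rule uA vA vu; rewrite nbhU_adj 1?e_sym // ?DN // /sim.
by case: (D _).
Qed.

Lemma simE u v : u \in A -> v \in A -> sim u v -> D [set u; v] = Some p.+1.
Proof.
move=> uA vA; have [->|vu] := eqVneq v u; first by rewrite setUid D1.
move=> uv; have := sim_rule uA vA vu; rewrite /sim in uv.
by case: (D [set u; v]) uv => //= k _; case: (D _) => // /eqP->.
Qed.

Lemma sim_nbh u v : u \in A -> v \in A -> v != u -> sim u v ->
  D (N v :|: [set u]) = None.
Proof.
move=> uA vA vu uv; have := sim_rule uA vA vu; rewrite simE //.
by case: (D _).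
Qed.

Lemma nsim_nbh u v : u \in A -> v \in A -> ~~ sim u v -> D (N v :|: [set u]) = Some p.
Proof.
move=> uA vA; have [->|vu] := eqVneq v u; first by rewrite sim_refl.
move=> uv; have := sim_rule uA vA vu; move: uv; rewrite /sim negbK => /eqP->.
by case: (D _) => //= k /eqP[->].
Qed.

Lemma sim_nadj u v : u \in A -> v \in A -> sim u v -> e u v = false.
Proof. by move=> uA vA; apply: contraTF; apply: adj_nsim. Qed.

(* If u and w were inequivalent, two orders of deletion would give two different
   degrees for the same subgraph. *)
Lemma sim_trans u v w : u \in A -> v \in A -> w \in A ->
  sim u v -> sim v w -> sim u w.
Proof.
move=> uA vA wA uv vw; apply: contraT => uw.
have uDv : u != v by apply: contraNneq uw => ->.
have vDw : v != w by apply: contraNneq uw => <-.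
have uDw : u != w by apply: contraNneq uw => ->; apply: sim_refl.
have euv := sim_nadj uA vA uv; have evw := sim_nadj vA wA vw.
have eqD (X Y : {set T}) : (forall z, (z \in X) = (z \in Y)) -> D X = D Y.
  by move=> XY; congr (d (_ :\: _)); apply/setP.
have u2 : u \in [set u; v] by rewrite !inE eqxx.
have wuv : w \notin [set u; v] by rewrite !inE negb_or ![w == _]eq_sym uDw vDw.
have R1 := del_rule uA u2 wA wuv erefl erefl.
rewrite (simE uA vA uv) in R1.
(* If G - u - v - w is acyclic, then G - N[u] - N[v] gets degree p - 1 from the rule at v in G -
   N[u], but p + 1 from the rule at w. *)
case Dt: (D (w |: [set u; v])) R1 => [t|] R1; last first.
  have v2 : v \in [set v; w] by rewrite !inE eqxx.
  have uvw : u \notin [set v; w] by rewrite !inE negb_or uDv uDw.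
  have := del_rule vA v2 uA uvw erefl erefl.
  rewrite (simE vA wA vw) (eqD _ (w |: [set u; v])) ?Dt; last first.
    by move=> z; rewrite !inE orbA orbC.
  case R2: (D (N u :|: [set v; w])) => [k|] //= /eqP[kp]; subst k.
  have DuN : D (N u :|: [set v]) = None by apply: sim_nbh; rewrite 1?sim_sym.
  have wX : w \notin N u :|: [set v].
    rewrite !inE !negb_or ![w == _]eq_sym uDw vDw andbT /=.
    apply/negP=> euw; move: R2; rewrite (eqD _ (N u :|: [set v])) ?DuN // => z.
    by rewrite !inE; case: (z =P w) => [->|]; rewrite ?euw ?orbT ?orbF.
  have uX : u \in N u :|: [set v] by rewrite !inE eqxx.
  have := del_rule uA uX wA wX erefl erefl.
  rewrite DuN (eqD _ (N u :|: [set v; w])) ?R2; last by solve_mem.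
  case R3: (D (N w :|: (N u :|: [set v]))) => [k|] //= /eqP pk; subst k.
  have wNu : w \notin N u by move: wX; rewrite inE negb_or => /andP[].
  have := del_rule uA (nbh_id e u) wA wNu erefl erefl.
  rewrite DN // setUC nsim_nbh // 1?sim_sym //.
  case R4: (D (N w :|: N u)) => [|] //= _.
  have vX : v \notin N w :|: N u.
    by rewrite !inE !negb_or vDw eq_sym uDv [e w v]e_sym evw euv.
  have uX2 : u \in N w :|: N u by rewrite inE nbh_id orbT.
  have := del_rule uA uX2 vA vX erefl erefl.
  rewrite R4 (eqD _ (N w :|: (N u :|: [set v]))) ?R3; last first.
    by solve_mem.
  case R5: (D (N v :|: (N w :|: N u))) => [k|] //= /eqP pk; subst k.
  have vNu : v \notin N u by rewrite !inE negb_or eq_sym uDv euv.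
  have := del_rule uA (nbh_id e u) vA vNu erefl erefl.
  rewrite DN // setUC DuN; case R6: (D (N v :|: N u)) => [q|] //= /eqP pq.
  have wX2 : w \notin N v :|: N u by rewrite inE negb_or wNu !inE negb_or eq_sym vDw evw.
  have uX3 : u \in N v :|: N u by rewrite inE nbh_id orbT.
  have := del_rule uA uX3 wA wX2 erefl erefl.
  rewrite R6 [X in delete_link _ _ X](eqD _ (N v :|: (N w :|: N u))) ?R5.
    by case: (D _) => //= /eqP qp; move: pq; rewrite qp; clear; lia.
  by solve_mem.
(* Otherwise it has degree p + 1, and G - N[v] - N[w] gets degree p - 1 from the rule at w in G -
   N[v], but p + 1 by comparison with deleting u as well. *)
case: (D _) R1 => //= /eqP tE; subst t.
have u3 : u \in [set u; w] by rewrite !inE eqxx.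
have vuw : v \notin [set u; w] by rewrite !inE negb_or eq_sym uDv vDw.
have := del_rule uA u3 vA vuw erefl erefl.
have -> : D [set u; w] = None by move: uw; rewrite /sim negbK => /eqP.
rewrite (eqD _ (w |: [set u; v])) ?Dt; last by solve_mem.
case R2: (D (N v :|: [set u; w])) => [k|] //= /eqP pk; subst k.
have DvN : D (N v :|: [set u]) = None by apply: sim_nbh; rewrite // eq_sym.
have wNv : w \notin N v by rewrite !inE negb_or eq_sym vDw evw.
have uNv : u \notin N v by rewrite !inE negb_or uDv e_sym euv.
have wX : w \notin N v :|: [set u] by rewrite inE negb_or wNv inE eq_sym uDw.
have vX : v \in N v :|: [set u] by rewrite inE nbh_id.
have := del_rule vA vX wA wX erefl erefl.
rewrite DvN (eqD _ (N v :|: [set u; w])) ?R2; last first.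
  by solve_mem.
case R3: (D (N w :|: (N v :|: [set u]))) => [k|] //= /eqP pk; subst k.
have := del_rule vA (nbh_id e v) wA wNv erefl erefl.
rewrite DN // setUC sim_nbh // 1?sim_sym //.
case R4: (D (N w :|: N v)) => [q|] //= /eqP pq.
have [uNw | uNw] := boolP (u \in N w).
  move: R3; rewrite (eqD _ (N w :|: N v)) ?R4; first by case=> qp; move: pq; rewrite qp; clear; lia.
  move=> z; move: uNw; rewrite !inE; case: (z =P u) => [->|_]; last by rewrite !orbF.
  by move=> ->.
have vX2 : v \in N w :|: N v by rewrite inE nbh_id orbT.
have uX : u \notin N w :|: N v by rewrite inE negb_or uNw uNv.
have := del_rule vA vX2 uA uX erefl erefl.
rewrite R4 (eqD _ (N w :|: (N v :|: [set u]))) ?R3.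
  by case: (D _) => //= /eqP qp; move: pq; rewrite qp; clear; lia.
by solve_mem.
Qed.

(** If x1 and x4 were inequivalent, G - x1 - x2 - x3 and its link at x4 would both have a class in
    degree p, whereas the rule puts the link one degree lower. *)
Lemma sim_path4 x1 x2 x3 x4 :
  x1 \in A -> x2 \in A -> x3 \in A -> x4 \in A ->
  e x1 x2 -> e x2 x3 -> e x3 x4 -> ~~ sim x1 x3 -> ~~ sim x2 x4 -> sim x1 x4.
Proof.
move=> A1 A2 A3 A4 e12 e23 e34 s13 s24; apply: contraT => s14.
have eqD (X Y : {set T}) : (forall z, (z \in X) = (z \in Y)) -> D X = D Y.
  by move=> XY; congr (d (_ :\: _)); apply/setP.
have neq x y : x \in A -> ~~ sim x y -> x != y.
  by move=> xA; apply: contraNneq => <-; apply: sim_refl.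
have n14 := neq _ _ A1 s14; have n24 := neq _ _ A2 s24.
have nadj x y : e x y -> x != y by apply: contraTneq => ->; rewrite e_irr.
have n12 := nadj _ _ e12; have n23 := nadj _ _ e23; have n34 := nadj _ _ e34.
have none x y : ~~ sim x y -> D [set x; y] = None by rewrite /sim negbK => /eqP.
have X24 : x2 \in [set x2; x4] by rewrite !inE eqxx.
have X24' : x1 \notin [set x2; x4] by rewrite !inE negb_or n12 n14.
have := del_rule A2 X24 A1 X24' erefl erefl.
rewrite none // [X in delete_link _ _ X](eqD _ (N x1 :|: [set x4])); last first.
  by move=> z; rewrite !inE; case: (z =P x2) => [->|]; rewrite ?e12 ?orbT.
rewrite nsim_nbh // 1?sim_sym //.
case R1: (D (x1 |: [set x2; x4])) => [k|] //= /eqP kp; subst k.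
have X12 : x1 \in [set x1; x2] by rewrite !inE eqxx.
have X12' : x4 \notin [set x1; x2] by rewrite !inE negb_or ![x4 == _]eq_sym n14 n24.
have := del_rule A1 X12 A4 X12' erefl erefl.
rewrite none ?adj_nsim // (eqD _ (x1 |: [set x2; x4])) ?R1; last first.
  by solve_mem.
case R2: (D (N x4 :|: [set x1; x2])) => [k|] //= /eqP kp; subst k.
have X13 : x1 \in [set x1; x3] by rewrite !inE eqxx.
have X13' : x2 \notin [set x1; x3] by rewrite !inE negb_or eq_sym n12 n23.
have := del_rule A1 X13 A2 X13' erefl erefl.
rewrite none // [X in delete_link _ _ X](eqD _ (N x2)) ?DN //; last first.
  move=> z; rewrite !inE; case: (z =P x1) => [->|]; first by rewrite e_sym e12 !orbT.
  by case: (z =P x3) => [->|]; rewrite ?e23 ?orbT ?orbF.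
case R3: (D (x2 |: [set x1; x3])) => [k|] //= /eqP kp; subst k.
have X123 : x1 \in x2 |: [set x1; x3] by rewrite !inE eqxx orbT.
have X123' : x4 \notin x2 |: [set x1; x3].
  by rewrite !inE !negb_or ![x4 == _]eq_sym n24 n14 n34.
have := del_rule A1 X123 A4 X123' erefl erefl.
rewrite R3 [X in delete_link _ _ X](eqD _ (N x4 :|: [set x1; x2])) ?R2.
  by case: (D _) => //= /eqP/n_Sn.
move=> z; rewrite !inE; case: (z =P x3) => [->|]; first by rewrite [e x4 _]e_sym e34 !orbT.
by rewrite orbF [(z == x2) || _]orbC.
Qed.

End Classes.

(** * Shortest directed cycles *)

Section DirectedCycles.

(** Iterating a chosen successor in a finite type must revisit a state; the stretch between the two
    visits is the cycle. *)
Lemma exists_cycle (S : finType) (Q : pred S) (R : rel S) s0 : Q s0 ->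
  (forall s, Q s -> exists2 s', R s s' & Q s') ->
  exists2 c, c != [::] & cycle R c.
Proof.
move=> Q0 next; pose g s := odflt s [pick s' | R s s' && Q s'].
have gP s : Q s -> R s (g s) && Q (g s).
  move=> /next[s' Rs' Qs']; rewrite /g; case: pickP => [//|/(_ s')].
  by rewrite Rs' Qs'.
have gQ i : Q (iter i g s0) by elim: i => //= i /gP/andP[].
have /trajectP[i lt_i Ei] := looping_order g s0; set n := fingraph.order g s0 in lt_i Ei.
pose x := iter i g s0; pose m := (n - i).-1.
exists (traject g x m.+1) => //; apply: (@sub_in_cycle _ Q (frel g)).
- by move=> y z yQ _ /= /eqP<-; have /andP[] := gP y yQ.
- apply/allP=> y /trajectP[k _ ->]; rewrite /x -iterD; exact: gQ.
rewrite /= rcons_path fpath_traject last_traject /= -iterS /x -iterD.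
have -> : m.+1 + i = n by rewrite /m; lia.
by rewrite Ei.
Qed.

Variables (T : finType) (e dir : rel T) (K : pred T) (col : T -> nat).
Hypothesis e_sym : symmetric e.
Hypothesis col_lt3 : forall u, col u < 3.
Hypothesis dirP : forall u w,
  dir u w -> [/\ K u, K w, e u w & col w = (col u).+1 %% 3].
Hypothesis dir_total : forall u w, K u -> K w -> e u w -> dir u w || dir w u.

Lemma col_path x s : path dir x s -> col (last x s) = (col x + size s) %% 3.
Proof.
elim: s x => [|y s IHs] x /=; first by rewrite addn0 modn_small.
by case/andP=> /dirP[_ _ _ cy] /IHs->; rewrite cy modnDml addSnnS.
Qed.

Lemma cycle_size3 s : cycle dir s -> 3 %| size s.
Proof.
case: s => [|x s] //= /col_path; rewrite last_rcons size_rcons.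
by have := col_lt3 x; lia.
Qed.

Lemma cycle_nth x0 s i : cycle dir s -> i < size s ->
  dir (nth x0 s i) (nth x0 s (i.+1 %% size s)).
Proof.
case: s => [|x s] //= /(pathP x0) H; rewrite ltnS => le_i.
have := H i; rewrite size_rcons ltnS => /(_ le_i).
rewrite -rcons_cons nth_rcons /= ltnS le_i nth_rcons.
have [lt_i | ge_i] := ltnP i (size s); first by rewrite modn_small.
have -> : i = size s by apply/eqP; rewrite eqn_leq le_i.
by rewrite eqxx modnn.
Qed.

(* A chord of a directed cycle, whichever way it points, closes up a shorter
   directed cycle; hence a shortest directed cycle is induced. *)
Lemma min_cycle_induced s : s != [::] -> cycle dir s ->
  (forall s', s' != [::] -> cycle dir s' -> size s <= size s') ->
  [/\ all K s, induced_cycle e s & 3 %| size s].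
Proof.
move=> s0 cs smin; have s3 := cycle_size3 cs.
have n3 : 3 <= size s by apply: dvdn_leq; rewrite // lt0n size_eq0.
have chord x0 i j : i < size s -> j < size s ->
    dir (nth x0 s i) (nth x0 s j) -> j = i.+1 %% size s.
  (* [m] is the distance from j to i along the cycle; that stretch of m + 1 vertices is closed by
     the arc from i to j. *)
  move=> lti ltj dij; pose m := if j <= i then i - j else i + size s - j.
  have ltm : m < size s by rewrite /m; case: ifP; lia.
  have rs : rot j s = nth x0 s j :: behead (rot j s).
    by rewrite /rot (drop_nth x0 ltj).
  have nthm : nth x0 (rot j s) m = nth x0 s i.
    rewrite /rot nth_cat size_drop /m; have [le_ji | lt_ij] := leqP j i.
      have -> : (i - j < size s - j) = true by lia.
      by rewrite nth_drop subnKC.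
    have -> : (i + size s - j < size s - j) = false by lia.
    have -> : i + size s - j - (size s - j) = i by lia.
    by rewrite nth_take.
  have c' : cycle dir (take m.+1 (rot j s)).
    move: cs; rewrite -(rot_cycle j) rs /= !rcons_path => /andP[pb _].
    have szb : size (behead (rot j s)) = (size s).-1 by rewrite size_behead size_rot.
    apply/andP; split.
      by move: pb; rewrite -{1}(cat_take_drop m (behead (rot j s))) cat_path => /andP[].
    rewrite (last_nth x0) size_takel; last by rewrite szb; lia.
    by rewrite -[_ :: take _ _]/(take m.+1 (_ :: behead _)) nth_take // -rs nthm.
  have : size s <= m.+1.
    rewrite -{1}(size_takel (s := rot j s) (n0 := m.+1)) ?size_rot //.
    by apply: smin c'; rewrite rs.
  rewrite /m; case: ifP => [le_ji | /negbT lt_ij] ?.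
    have -> : i.+1 = size s by lia.
    by rewrite modnn; lia.
  by rewrite modn_small; lia.
have allK : all K s.
  apply/allP=> x xs; have /(nthP x)[i lti <-] := xs.
  by have [] := dirP (cycle_nth x cs lti).
have us : uniq s.
  case: s s0 cs smin s3 n3 chord allK => // x0 s' _; set s := x0 :: s'.
  (* If positions i < j carry the same vertex, the arc from j - 1 to j is also a chord from j - 1 to
     i. *)
  move=> cs smin s3 n3 chord allK; apply: contraT => /(uniqPn x0)[i [j [ltij ltj Eij]]].
  have /(cycle_nth x0 cs) : j.-1 < size s by lia.
  rewrite prednK ?modn_small -?Eij //; last by lia.
  move/chord; rewrite prednK ?modn_small //; last by lia.
  by move=> /(_ _ _) h; have := h _ _; lia.
split=> //; split=> // x0 i j lti ltj.
apply/idP/orP => [eij | [] /eqP->]; last first.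
- by rewrite e_sym; have [] := dirP (cycle_nth x0 cs ltj).
- by have [] := dirP (cycle_nth x0 cs lti).
have Ki k : k < size s -> K (nth x0 s k) by move=> lk; apply: (allP allK); rewrite mem_nth.
by case/orP: (dir_total (Ki _ lti) (Ki _ ltj) eij) => /chord ->; rewrite ?eqxx; auto.
Qed.

End DirectedCycles.

(** * Walks through three classes *)

Lemma mod3_third a b c : a < 3 -> b < 3 -> c < 3 ->
  b == a.+1 %% 3 -> b != c -> a != c -> c == b.+1 %% 3.
Proof. by case: a => [|[|[|?]]] //; case: b => [|[|[|?]]] //; case: c => [|[|[|?]]]. Qed.

Lemma mod3_total a b : a < 3 -> b < 3 -> a != b -> (b == a.+1 %% 3) || (a == b.+1 %% 3).
Proof. by case: a => [|[|[|?]]] //; case: b => [|[|[|?]]]. Qed.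

Section ThreeClasses.
Variables (T : finType) (e : rel T) (A : {set T}) (sim : rel T).
Hypothesis e_sym : symmetric e.
Hypothesis sim_sym : symmetric sim.
Hypothesis sim_refl : {in A, reflexive sim}.
Hypothesis sim_trans : forall u v w, u \in A -> v \in A -> w \in A ->
  sim u v -> sim v w -> sim u w.
Hypothesis adj_nsim : forall u v, u \in A -> v \in A -> e u v -> ~~ sim u v.
Hypothesis sim_path4 : forall x1 x2 x3 x4,
  x1 \in A -> x2 \in A -> x3 \in A -> x4 \in A ->
  e x1 x2 -> e x2 x3 -> e x3 x4 -> ~~ sim x1 x3 -> ~~ sim x2 x4 -> sim x1 x4.
Hypothesis two_nbrs : forall v, v \in A ->
  exists y y', [/\ y \in A, y' \in A, e v y, e v y' & ~~ sim y y'].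

Lemma next_nbr u w : u \in A -> w \in A -> exists2 x, x \in A & e w x && ~~ sim u x.
Proof.
move=> uA wA; have [y [y' [yA y'A wy wy' yy']]] := two_nbrs wA.
have [uy | uy] := boolP (sim u y); last by exists y; rewrite // wy.
exists y'; rewrite // wy' /=; apply: contra yy' => uy'.
by apply: (sim_trans _ uA) => //; rewrite sim_sym.
Qed.

(* A walk that never turns back into the class it came from runs cyclically
   through three classes, by [sim_path4]; orient the edges among them accordingly. *)
Lemma not_ternary v0 : v0 \in A -> ~ ternary_on e A.
Proof.
move=> v0A; have [y [y' [yA y'A vy vy' yy']]] := two_nbrs v0A.
(* The pairwise distinct classes of y, v0 and y' receive the colours 0, 1 and 2. *)
pose K x := [&& x \in A & [|| sim x y, sim x v0 | sim x y']].
pose col x := if sim x y then 0 else if sim x v0 then 1 else 2.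
pose dir u w := [&& K u, K w, e u w & col w == (col u).+1 %% 3].
have KA u : K u -> u \in A by case/andP.
have col3 u : col u < 3 by rewrite /col; do 2?case: ifP.
have yv : ~~ sim y v0 by apply: adj_nsim; rewrite // e_sym.
have vy'n : ~~ sim v0 y' by apply: adj_nsim.
have tr u v w : u \in A -> v \in A -> w \in A -> sim u v -> sim u w -> sim v w.
  by move=> uA vA wA uv; apply: sim_trans => //; rewrite sim_sym.
have colK u w : K u -> K w -> (col u == col w) = sim u w.
  move=> Ku Kw; have uA := KA u Ku; have wA := KA w Kw.
  have t a b : a \in A -> b \in A -> sim u w -> sim u a -> sim w b -> sim a b.
    by move=> aA bA uw ua wb; apply: (sim_trans aA wA bA) => //; rewrite sim_sym; apply: (tr u).
  have t' a : a \in A -> sim u a -> sim w a -> sim u w.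
    by move=> aA ua wa; apply: (sim_trans uA aA wA) => //; rewrite sim_sym.
  have nyv := negPf yv; have nvy' := negPf vy'n; have nyy' := negPf yy'.
  have nvy : sim v0 y = false by rewrite sim_sym.
  have ny'v : sim y' v0 = false by rewrite sim_sym.
  have ny'y : sim y' y = false by rewrite sim_sym.
  move: Ku Kw; rewrite /K /col uA wA /=.
  case uy: (sim u y); case wy: (sim w y) => /=.
  - by rewrite (t' y).
  - move=> _; case wv: (sim w v0); [move=> _ | move=> /= wy'].
      by apply/esym/negP=> uw; have := t _ _ yA v0A uw uy wv; rewrite nyv.
    by apply/esym/negP=> uw; have := t _ _ yA y'A uw uy wy'; rewrite nyy'.
  - case uv: (sim u v0); [move=> _ _ | move=> /= uy' _].
      by apply/esym/negP=> uw; have := t _ _ v0A yA uw uv wy; rewrite nvy.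
    by apply/esym/negP=> uw; have := t _ _ y'A yA uw uy' wy; rewrite ny'y.
  case uv: (sim u v0); case wv: (sim w v0) => /=.
  - by rewrite (t' v0).
  - move=> _ wy'; apply/esym/negP=> uw; have := t _ _ v0A y'A uw uv wy'.
    by rewrite nvy'.
  - move=> uy' _; apply/esym/negP=> uw; have := t _ _ y'A v0A uw uy' wv.
    by rewrite ny'v.
  by move=> uy' wy'; rewrite (t' y').
have adjcol u w : K u -> K w -> e u w -> col u != col w.
  by move=> Ku Kw uw; rewrite colK // adj_nsim ?KA.
(* States are arcs from u to w with a vertex t before u, so that [sim_path4] applies to t, u, w and
   the vertex after w. *)
pose Q (s : T * T) := dir s.1 s.2 && [exists t, [&& K t, e t s.1 & ~~ sim t s.2]].
pose R (s s' : T * T) := [&& dir s.1 s.2 & s'.1 == s.2].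
have Ky : K y by rewrite /K yA sim_refl.
have Kv : K v0 by rewrite /K v0A sim_refl ?orbT.
have Ky' : K y' by rewrite /K y'A sim_refl ?orbT.
have Q0 : Q (y, v0).
  have coly : col y = 0 by rewrite /col sim_refl.
  have colv : col v0 = 1 by rewrite /col sim_sym (negPf yv) sim_refl.
  rewrite /Q /dir /= Ky Kv e_sym vy coly colv /=.
  (* On the path y', v0, y, t, [sim_path4] puts t in the class of y'. *)
  have [t tA /andP[yt vt]] := next_nbr v0A yA.
  have sty' : sim y' t.
    by apply: (sim_path4 y'A v0A yA tA) => //; rewrite 1?e_sym // sim_sym.
  apply/existsP; exists t; rewrite e_sym yt sim_sym vt andbT.
  by rewrite /K tA [sim t y']sim_sym sty' !orbT.
have Qnext s : Q s -> exists2 s', R s s' & Q s'.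
  case: s => u w /andP[/= duw /existsP[t /and3P[Kt tu tw]]].
  have /and4P[Ku Kw uw cw] := duw.
  (* A neighbour x of w outside the class of u is equivalent to t, hence stays in [K], and can only
     have the third colour. *)
  have [x xA /andP[wx ux]] := next_nbr (KA _ Ku) (KA _ Kw).
  have tx : sim t x by apply: (sim_path4 (KA _ Kt) (KA _ Ku) (KA _ Kw) xA).
  have Kx : K x.
    case/andP: Kt => tA /or3P[] h; rewrite /K xA /=.
    - by rewrite (tr t x y).
    - by rewrite (tr t x v0) ?orbT.
    - by rewrite (tr t x y') ?orbT.
  exists (w, x); first by rewrite /R /= duw eqxx.
  apply/andP; split=> /=; last by apply/existsP; exists u; rewrite Ku uw.
  rewrite /dir Kw Kx wx /=.
  apply: (mod3_third (col3 u) (col3 w) (col3 x) cw (adjcol _ _ Kw Kx wx)).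
  by rewrite colK.
have [c c0 cR] := exists_cycle Q0 Qnext.
have cyc : cycle dir (map fst c).
  rewrite cycle_map; apply: sub_cycle cR => s s' /andP[ds /eqP Es] /=.
  by rewrite Es.
(* Positive length is required because the empty sequence counts as a cycle. *)
pose P n := [exists t : n.-tuple T, (0 < n) && cycle dir t].
have exP : exists n, P n.
  exists (size (map fst c)); apply/existsP; exists (in_tuple (map fst c)).
  by rewrite cyc andbT; case: (c) c0.
case: (ex_minnP exP) => n /existsP[s /andP[n0 cs]] nmin.
have [allK ind s3] : [/\ all K s, induced_cycle e s & 3 %| size s].
  apply: (@min_cycle_induced T e dir K col) => //.
  - by move=> u w /and4P[? ? ? /eqP].
  - move=> u w Ku Kw uw; rewrite /dir Ku Kw uw [e w u]e_sym uw /=.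
    exact: mod3_total (adjcol _ _ Ku Kw uw).
  - by case: (s) n0 => -[|? ?] //= /eqP <-.
  move=> s' s'0 cs'; rewrite size_tuple; apply: nmin; apply/existsP.
  by exists (in_tuple s'); rewrite cs' andbT; case: (s') s'0.
case; exists s; split=> //; apply/allP=> x xs; apply: KA; exact: (allP allK).
Qed.

End ThreeClasses.

(** * Ternary graphs *)

Section Ternary.
Variables (F : fieldType) (T : finType) (e : rel T).
Hypothesis F2 : (1 + 1 = 0 :> F)%R.
Hypotheses (e_sym : symmetric e) (e_irr : irreflexive e).
Implicit Types (A J : {set T}) (x v : T).

Let b A k := betti F e k A.

Lemma ternary_onS A J : J \subset A -> ternary_on e A -> ternary_on e J.
Proof.
move=> /subsetP JA tA [s [sJ cs s3]]; apply: tA; exists s; split=> //.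
by apply/allP=> x /(allP sJ)/JA.
Qed.

Lemma properD_nbh A x : x \in A -> A :\: nbh e x \proper A.
Proof.
by move=> xA; rewrite properE subsetDl; apply/subsetPn; exists x; rewrite // inE nbh_id.
Qed.

Lemma betti_delete_link A x oB oC : x \in A ->
  single (b (A :\ x)) oB -> single (b (A :\: nbh e x)) oC ->
  (exists2 oA, single (b A) oA & delete_link oA oB oC) \/
  (exists a c, [/\ oB = Some a, oC = Some c &
     forall k, b A k = ((k == a) + (k == c.+1))%N]).
Proof.
move=> xA; have [dl [dB dC d0 dS]] := betti_les F2 e_sym e_irr xA.
exact: single_les dB dC d0 dS.
Qed.

Lemma betti_ternary A : ternary_on e A -> exists o, single (b A) o.
Proof.
have [n] := ubnP #|A|; elim: n A => // n IHn A; rewrite ltnS => leAn tA.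
apply: NNPP => nA.
(* [d] is meaningful on proper subsets of A; its value at A is arbitrary. *)
pose d J := epsilon (inhabits None) (fun o => single (b J) o).
have dP J : J \proper A -> single (b J) (d J).
  move=> JA; apply: epsilon_spec; apply: IHn.
    exact: leq_trans (proper_card JA) leAn.
  exact: ternary_onS (proper_sub JA) tA.
have d_rule (J : {set T}) x : J \proper A -> x \in J ->
    delete_link (d J) (d (J :\ x)) (d (J :\: nbh e x)).
  move=> JA xJ; have JxA : J :\ x \proper A := proper_trans (properD1 xJ) JA.
  have JNA : J :\: nbh e x \proper A := proper_trans (properD_nbh xJ) JA.
  case: (betti_delete_link xJ (dP _ JxA) (dP _ JNA)) => [[o ho]|[a [c [_ _ h]]]].
    by rewrite (single_uniq (dP J JA) ho).
  by case: (single_two (dP J JA) h).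
have d_crit v : v \in A -> exists a c, [/\ d (A :\: [set v]) = Some a,
    d (A :\: nbh e v) = Some c & forall k, b A k = ((k == a) + (k == c.+1))%N].
  move=> vA.
  (* At A the alternatives trade places: a single class is excluded by assumption, so both classes
     survive. *)
  have [[o ho _]|//] := betti_delete_link vA (dP _ (properD1 vA)) (dP _ (properD_nbh vA)).
  by case: nA; exists o.
have no_isolated v : v \in A -> exists2 u, u \in A & e v u.
  move=> vA; apply: NNPP => iso; apply: nA; exists None => k.
  apply: (betti_isolated F2 e_sym e_irr vA) => u uA.
  by apply/negP=> vu; apply: iso; exists u.
have [v0 v0A] : exists v, v \in A.
  have [A0|[v vA]] := set_0Vmem A; last by exists v.
  case: nA; exists (Some 0) => k; rewrite /b A0 (betti_set0 F e).
  by case: k.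
have [|p pP] := crit_const e_sym e_irr d_rule d_crit no_isolated; first by exists v0.
have D1 v : v \in A -> d (A :\: [set v]) = Some p.+1 by move/pP=> [].
have DN v : v \in A -> d (A :\: nbh e v) = Some p by move/pP=> [].
apply: (@not_ternary T e A (sim A d) _ _ _ _ _ _ _ v0) => //.
- by move=> u v; rewrite sim_sym.
- by move=> u uA; apply: (sim_refl D1).
- exact: (sim_trans e_sym e_irr d_rule D1 DN).
- exact: (adj_nsim e_sym e_irr d_rule D1 DN).
- exact: (sim_path4 e_sym e_irr d_rule D1 DN).
move=> v vA.
have [_ /(_ erefl)] := nbh_pair e_sym e_irr d_rule d_crit no_isolated vA (D1 v vA) (DN v vA).
case=> y [y' [yA y'A vy vy' yy']]; exists y, y'; split=> //.
by rewrite /sim yy'.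
Qed.

(** * Alternating counts of independent sets *)

Local Open Scope ring_scope.

Definition alt_count A : int := \sum_(S : {set T} | independent e S && (S \subset A)) (-1) ^+ #|S|.

Lemma alt_count_rec A x : x \in A ->
  alt_count A = alt_count (A :\ x) - alt_count (A :\: nbh e x).
Proof.
move=> xA; rewrite /alt_count (bigID (fun S : {set T} => x \in S)) /= addrC; congr (_ + _).
  by apply: eq_bigl => S; rewrite subsetD1 andbA.
rewrite (reindex_onto (fun S => x |: S) (fun S => S :\ x)) /=; last first.
  by move=> S /andP[_ xS]; rewrite setD1K.
rewrite -sumrN; apply: eq_big => S.
  have [xS | xS] := boolP (x \in S).
    have -> : (S \subset A :\: nbh e x) = false.
      by apply/negP=> /subsetP/(_ x xS); rewrite !inE eqxx.
    have -> : ((x |: S) :\ x == S) = false.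
      by apply/negP=> /eqP Sx; move: xS; rewrite -Sx !inE eqxx.
    by rewrite !andbF.
  rewrite setU11 setU1K // eqxx !andbT.
  have := face_setU1 e_sym e_irr #|S| xA xS.
  by rewrite /face cardsU1 xS !eqxx !andbT.
move=> /andP[_ /eqP Sx]; have xS : x \notin S by rewrite -Sx !inE eqxx.
by rewrite cardsU1 xS exprS mulN1r.
Qed.

(** This is the Euler characteristic up to sign; each pattern allowed by [delete_link] matches the
    recursion at x. *)
Lemma alt_count_betti A o : ternary_on e A -> single (b A) o ->
  alt_count A = if o is Some k then (-1) ^+ k else 0.
Proof.
have [n] := ubnP #|A|; elim: n A o => // n IHn A o; rewrite ltnS => leAn tA hA.
have [A0|[x xA]] := set_0Vmem A.
  have -> : o = Some 0%N.
    apply: single_uniq hA _ => k; rewrite /b A0 (betti_set0 F e).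
    by case: k.
  rewrite /alt_count (big_pred1 set0) ?cards0 // => S; rewrite A0 subset0 andbC.
  by rewrite /=; case: (S =P set0) => [->|//]; apply/independentP=> ? ?; rewrite inE.
have ltB : (#|A :\ x| < n)%N by apply: leq_trans leAn; rewrite proper_card ?properD1.
have ltC : (#|A :\: nbh e x| < n)%N by apply: leq_trans leAn; rewrite proper_card ?properD_nbh.
have tB := ternary_onS (subsetDl A [set x]) tA.
have tC := ternary_onS (subsetDl A (nbh e x)) tA.
have [oB hB] := betti_ternary tB; have [oC hC] := betti_ternary tC.
rewrite (alt_count_rec xA) (IHn _ _ ltB tB hB) (IHn _ _ ltC tC hC).
case: (betti_delete_link xA hB hC) => [[o' ho']|[a [c [_ _ h]]]]; last by case: (single_two hA h).
rewrite (single_uniq hA ho').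
case: o' {ho'} => [i|]; case: oB {hB} => [j|]; case: oC {hC} => [k|] //=.
- by move/eqP->; rewrite subr0.
- by move/eqP->; rewrite exprS mulN1r sub0r.
by move/eqP->; rewrite subrr.
Qed.

Lemma alt_count_ternary A : ternary_on e A -> `|alt_count A| <= 1.
Proof.
move=> tA; have [o ho] := betti_ternary tA; rewrite (alt_count_betti tA ho).
by case: o {ho} => [k|]; rewrite ?normrX ?normrN1 ?expr1n ?normr0.
Qed.

(** Each vertex of D removed branches into two graphs with fewer vertices of D; once none is left
    the graph is ternary. *)
Lemma alt_count_decycling D A : decycling3 e D -> `|alt_count A| <= 2 ^+ #|A :&: D|.
Proof.
move=> tD; have [n] := ubnP #|A|; elim: n A => // n IHn A; rewrite ltnS => leAn.
have [AD | [x]] := set_0Vmem (A :&: D).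
  rewrite AD cards0 expr0 alt_count_ternary //; apply: ternary_onS tD.
  by rewrite -disjoints_subset -setI_eq0 AD.
rewrite inE => /andP[xA xD]; rewrite (alt_count_rec xA).
have -> : #|A :&: D| = #|(A :\ x) :&: D|.+1.
  by rewrite (cardsD1 x) inE xA xD setIDAC.
apply: le_trans (ler_normB _ _) _; rewrite exprS mulrDl mul1r lerD //.
  by apply: IHn; apply: leq_trans leAn; rewrite proper_card ?properD1.
apply: le_trans (IHn _ _) _.
  by apply: leq_trans leAn; rewrite proper_card ?properD_nbh.
rewrite ler_eXn2l // subset_leq_card // setSI // setDS //.
by rewrite sub1set nbh_id.
Qed.

End Ternary.

Lemma phi3_attained (T : finType) (e : rel T) :
  exists2 D, decycling3 e D & #|D| = phi3 e.
Proof.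
rewrite /phi3; apply: (big_ind (fun n => exists2 D, decycling3 e D & #|D| = n)).
(* The default value is attained by [setT], since no cycle fits in the empty set. *)
- exists setT; last by rewrite cardsT.
  case=> -[|x s] [sT [s3 _ _] _] //.
  by have := allP sT x; rewrite !inE eqxx => /(_ isT).
- by move=> m n hm hn; rewrite /minn; case: ifP.
move=> D; rewrite /decycling3b; case: excluded_middle_informative => // hD _.
by exists D.
Qed.

Theorem theorem1p5 (T : finType) (e : rel T) :
  simple_graph e ->
  (`|indep_poly_at_m1 e| <= 2%:Z ^+ phi3 e)%R.
Proof.
case=> e_sym e_irr; have [D tD <-] := phi3_attained e.
have F2 : (1 + 1 = 0 :> 'F_2)%R by apply: val_inj.
have := alt_count_decycling F2 e_sym e_irr setT tD; rewrite setTI.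
congr (`|_| <= _)%R; apply: eq_bigl => S.
by rewrite subsetT andbT.
Qed.
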